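(* Let $C$ be a convex, closed and non-empty subset of $\mathbb{R}^n$, $K:C\rightrightarrows C$ be a set-valued map and $f:\mathbb{R}^n\times\mathbb{R}^n\to\mathbb{R}$ be a function. Suppose that the quasi-equilibrium problem associated to $f$ and $K$ satisfies the uniform coerciveness condition (UCC) with coercive radius $\rho>0$, and that the following properties hold: \begin{enumerate} \item $K$ is closed with convex and non-empty values; \item $f(\cdot,y)$ is upper semi-continuous, for all $y\in C$; \item $f(x,\cdot)$ is quasi-convex, for all $x\in C$; \item the set $D=\{x\in C\cap\overline{B}_\rho:\ \inf_{y\in K(x)\cap\overline{B}_\rho} f(x,y)<0\}$ is open in $C\cap\overline{B}_\rho$; \item $f$ vanishes on the diagonal of $C\times C$; \item for each $x\in\mathrm{Fix}(K)$ and all $y,z\in\mathbb{R}^n$, the following implication holds: \[ \bigl(f(x,y)\leq 0 \text{ and } f(x,z)<0\bigr)\Rightarrow f(x,ty+(1-t)z)<0 \text{ for all } t\in\,]0,1[. \] \end{enumerate} Then the quasi-equilibrium problem admits at least one solution, i.e. there exists $x_0\in C$ such that $x_0\in K(x_0)$ and $f(x_0,y)\geq 0$ for all $y\in K(x_0)$.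
   Context: $B_\rho$ and $\overline{B}_\rho$ denote the open and closed balls in $\mathbb{R}^n$ with centre $0$ and radius $\rho$. For $K:C\rightrightarrows C$, $\mathrm{Fix}(K):=\{x\in C: x\in K(x)\}$. A set-valued map is closed if its graph is a closed subset of the product space. A function $h:\mathbb{R}^n\to\mathbb{R}$ is quasi-convex if $h(tx+(1-t)y)\leq\max\{h(x),h(y)\}$ for all $x,y\in\mathbb{R}^n$, $t\in[0,1]$. Uniform coerciveness condition (UCC): the quasi-equilibrium problem associated to $f$ and $K$ satisfies the UCC with coercive radius $\rho>0$ if (i) $K(w)\cap B_\rho\neq\emptyset$ for all $w\in C$; and (ii) for each $z\in\mathrm{Fix}(K)$ there exists $\rho_z\in\,]0,\rho[$ such that for every $x\in (K(z)\cap\overline{B}_\rho)\setminus\overline{B}_{\rho_z}$ there exists $y\in K(z)$ with $\|y\|<\|x\|$ and $f(x,y)\leq 0$. *)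

(* Defs.v *)
From HB Require Import structures.
From mathcomp Require Import all_boot all_order all_algebra.
From mathcomp Require Import all_classical all_reals all_analysis.

Set Implicit Arguments.
Unset Strict Implicit.
Unset Printing Implicit Defensive.

Import Order.TTheory GRing.Theory Num.Theory.
Import numFieldNormedType.Exports.

Local Open Scope classical_set_scope.
Local Open Scope ring_scope.

(* The library norm `|x| on 'rV[R]_n is the sup norm; it induces the usual
   topology of R^n, but balls and the coerciveness condition refer to the
   Euclidean norm. *)
Definition enorm (R : realType) (n : nat) (x : 'rV[R]_n) : R :=
  Num.sqrt (\sum_(i < n) x 0 i ^+ 2).

Definition oball (R : realType) (n : nat) (rho : R) : set 'rV[R]_n :=
  [set x | enorm x < rho].

Definition cball (R : realType) (n : nat) (rho : R) : set 'rV[R]_n :=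
  [set x | enorm x <= rho].

(* A set-valued map from C to itself is a total function K : T -> set T such
   that K x `<=` C for x in C; the values of K outside C are irrelevant, so the
   graph and the fixed points are restricted to C. *)
Definition graph (T : Type) (C : set T) (K : T -> set T) : set (T * T) :=
  [set p | C p.1 /\ K p.1 p.2].

Definition Fix (T : Type) (C : set T) (K : T -> set T) : set T :=
  [set x | C x /\ K x x].

(* Closedness relative to the product space C x C. *)
Definition closed_setmap (T : topologicalType) (C : set T) (K : T -> set T)
  : Prop := closed (graph C K : set (subspace (C `*` C))).

Definition upper_semicontinuous (T : topologicalType) (R : realType)
    (h : T -> R) : Prop :=
  forall (x : T) (a : R), h x < a -> \forall y \near x, h y < a.

Definition quasiconvex (R : realType) (n : nat) (h : 'rV[R]_n -> R) : Prop :=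
  forall (x y : 'rV[R]_n) (t : R), 0 <= t <= 1 ->
    h (t *: x + (1 - t) *: y) <= Num.max (h x) (h y).

Definition UCC (R : realType) (n : nat) (C : set 'rV[R]_n)
    (K : 'rV[R]_n -> set 'rV[R]_n) (f : 'rV[R]_n -> 'rV[R]_n -> R) (rho : R)
  : Prop :=
  (forall w, C w -> K w `&` oball rho !=set0) /\
  (forall z, Fix C K z ->
    exists rhoz : R, 0 < rhoz < rho /\
      forall x, ((K z `&` cball rho) `\` cball rhoz) x ->
        exists y, [/\ K z y, enorm y < enorm x & f x y <= 0]).

(* The infimum is taken in the extended reals, as f x may be unbounded below. *)
Definition negative_inf_set (R : realType) (n : nat) (C : set 'rV[R]_n)
    (K : 'rV[R]_n -> set 'rV[R]_n) (f : 'rV[R]_n -> 'rV[R]_n -> R) (rho : R)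
  : set 'rV[R]_n :=
  [set x | (C `&` cball rho) x /\
     (ereal_inf [set (f x y)%:E | y in K x `&` cball rho] < 0)%E].

(* Main.v *)
Require Import Defs.
From HB Require Import structures.
From mathcomp Require Import all_boot all_order all_algebra.
From mathcomp Require Import all_classical all_reals all_analysis.
From mathcomp Require Import ring lra zify.

(** Restrict everything to the compact convex set X = C `&` cball rho, with
    S x = K x `&` cball rho and F x = {y | f x y < 0}.  By the definition of the
    set D, a point x of X lies in D if and only if S x meets F x.

    A point x of X with S x x outside D exists ([compact_quasi_equilibrium]).
    Otherwise every x in X \ D is outside S x, so a linear form p separates x
    from S x strictly, and still separates b from S b for b near x because S has a
    closed graph.  Finitely many such neighbourhoods cover the compact set
    X \ D; let A_i be slightly smaller closed balls that still cover it, and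
    A_0 the complement of their interiors, a closed part of D.  Let Phi b be
    the set of y in X such that f b y < 0 if b is in A_0, and p_i (y - b) < 0
    whenever b is in A_i.  The point of this choice is that Phi has nonempty
    convex values (quasi-convexity), open inverse images (closedness of the
    A_i and upper semi-continuity of f in its first argument), and no fixed
    point, whereas S itself need not be lower semi-continuous.  This contradicts
    the Fan-Browder fixed point theorem ([fan_browder]).

    The Fan-Browder theorem is deduced from Kuhn's cubical version of Sperner's
    lemma ([kuhn_cube]) by mapping a fine grid into X: a grid point is sent to
    an iterated convex combination ([stick]) of finitely many selected values.
    Kuhn's lemma is obtained by a Stokes argument modulo 2: the cup product of
    the coboundaries of the labels is itself a coboundary, and its sum over the
    grid is computed on the boundary, where the labels are known.

    Finally the point x so found satisfies 0 <= f x y for y in K x within the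
    ball, and has to be compared with an arbitrary y in K x.  The coerciveness
    condition gives w in K x with enorm w < rho and f x w <= 0 (w = x if x
    itself is small).  If f x y < 0, then f x is negative on the open segment
    from w to y, which contains points of K x in the ball: a contradiction. *)

Set Implicit Arguments.
Unset Strict Implicit.
Unset Printing Implicit Defensive.

Import Order.TTheory GRing.Theory Num.Theory.
Import numFieldNormedType.Exports.

Local Open Scope ring_scope.

(** * Kuhn's cubical lemma *)

Section KuhnLemma.
Variable M : nat.
Local Notation lattice := {ffun 'I_M -> nat}.
Implicit Types (x y : lattice) (A : {set 'I_M}) (s : seq 'I_M).

(** The lattice point x moved by one in direction j. *)
Definition step (j : 'I_M) x : lattice := [ffun i => (x i + (i == j))%N].

(** A cubical cochain modulo 2 assigns a boolean to each cube, given by its set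
    of directions A and its lowest vertex x; booleans are used as the field with
    two elements.  This is the coboundary operator. *)
Definition cobd (w : {set 'I_M} -> lattice -> bool) A x : bool :=
  \sum_(j in A) (w (A :\ j) (step j x) + w (A :\ j) x).

(** The cup product dg_1 dg_2 ... dg_r of the coboundaries of the 0-cochains
    listed in gs; the empty product is the constant 1. *)
Fixpoint cup (gs : seq (lattice -> bool)) A x : bool :=
  if gs is g :: gs' then
    \sum_(j in A) (g (step j x) + g x) * cup gs' (A :\ j) (step j x)
  else 1.

Lemma step_comm j l x : step j (step l x) = step l (step j x).
Proof. by apply/ffunP => i; rewrite !ffunE addnAC. Qed.

Lemma add_self_bool (b : bool) : b + b = 0.
Proof. by case: b. Qed.

Lemma sum_sym_offdiag A (S : 'I_M -> 'I_M -> bool) :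
  (forall i j, S i j = S j i) ->
  \sum_(i in A) \sum_(j in A :\ i) S i j = 0.
Proof.
move=> Ssym.
have -> : \sum_(i in A) \sum_(j in A :\ i) S i j =
    \sum_(i in A) \sum_(j in A | (i < j)%N) S i j +
    \sum_(i in A) \sum_(j in A | (j < i)%N) S i j.
  rewrite -big_split /=; apply: eq_bigr => i _.
  rewrite (bigID (fun j : 'I_M => (i < j)%N)) /=.
  congr (_ + _); apply: eq_bigl => j; rewrite !inE -(inj_eq val_inj) /=;
    by case: ltngtP; rewrite ?andbT ?andbF.
rewrite [X in _ + X](exchange_big_dep (mem A)) /=; last by move=> i j _ /andP[].
rewrite -big_split /= big1// => i iA.
rewrite -[RHS](add_self_bool (\sum_(j in A | (i < j)%N) S i j)).
congr (_ + _); apply: eq_big => [j|j _]; last exact: Ssym.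
by rewrite iA.
Qed.

Lemma cobd_cobd w A x : cobd (cobd w) A x = 0.
Proof.
rewrite /cobd; under eq_bigr => j _ do rewrite -big_split /=.
apply: sum_sym_offdiag => i j.
have -> : A :\ i :\ j = A :\ j :\ i by rewrite !finset.setDDl finset.setUC.
rewrite (step_comm i j) !addrA; congr (_ + _).
by rewrite -!addrA; congr (_ + _); rewrite addrC.
Qed.

(** Leibniz rule: since [cup gs] is closed, multiplying it by dg amounts to
    taking the coboundary of g times [cup gs]. *)
Lemma cup_cons g gs A x : cobd (cup gs) A x = 0 ->
  cup (g :: gs) A x = cobd (fun B y => g y * cup gs B y) A x.
Proof.
move=> cl; rewrite -[LHS]addr0 -(mulr0 (g x)) -cl /= /cobd mulr_sumr -big_split /=.
apply: eq_bigr => j _; rewrite mulrDr mulrDl -!addrA; congr (_ + _).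
by rewrite addrA add_self_bool add0r.
Qed.

Lemma eq_cobd w w' A x : (forall B y, w B y = w' B y) -> cobd w A x = cobd w' A x.
Proof. by move=> ww'; apply: eq_bigr => j _; rewrite !ww'. Qed.

Lemma cobd_cup gs A x : cobd (cup gs) A x = 0.
Proof.
elim: gs A x => [|g gs IH] A x; first by rewrite /cobd big1.
by rewrite (eq_cobd (w' := cobd (fun B y => g y * cup gs B y)))
  ?cobd_cobd// => B y; rewrite cup_cons.
Qed.

(** The product vanishes on the cubes inside a face of the grid on which one of
    the functions is constant. *)
Lemma cup_face (T : eqType) (g : T -> lattice -> bool) (s : seq T) A x j a e t :
  t \in s -> j \notin A -> x j = a -> (forall y, y j = a -> g t y = e) ->
  cup [seq g i | i <- s] A x = 0.
Proof.
move=> ts + + gt; elim: s ts A x => //= i s IH; rewrite inE => its A x jA xj.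
rewrite big1// => l lA.
have xlj : step l x j = a.
  by rewrite ffunE (negPf (contraNneq _ jA)) ?addn0// => ->.
case/predU1P: its => [ti|ts].
  by rewrite -ti !gt// add_self_bool mul0r.
by rewrite IH ?mulr0// !inE negb_and jA orbT.
Qed.

(** A nonzero product on a cube forces every factor to be nonconstant on the
    vertices of that cube. *)
Lemma cup_neq0 (T : eqType) (g : T -> lattice -> bool) (s : seq T) A x :
  cup [seq g i | i <- s] A x -> forall t, t \in s ->
  exists y y', [/\ forall i, (x i <= y i <= x i + (i \in A))%N,
    forall i, (x i <= y' i <= x i + (i \in A))%N, ~~ g t y & g t y'].
Proof.
elim: s A x => //= i s IH A x /eqP; rewrite -[true]/(1 : bool) => c1.
have /existsP[j /andP[jA]] :
    [exists j, (j \in A) && ((g i (step j x) + g i x) *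
      cup [seq g i | i <- s] (A :\ j) (step j x))].
  apply: contra_eqT c1 => /existsPn h; rewrite big1// => j jA.
  by move: (h j); rewrite jA /= => /negbTE.
have bx l : (x l <= x l <= x l + (l \in A))%N by rewrite leqnn leq_addr.
have bj l : (x l <= step j x l <= x l + (l \in A))%N.
  rewrite ffunE leq_addr leq_add2l; case: eqP => [->|//].
  by rewrite jA.
case/andP => gij cs t; rewrite inE => /predU1P[->|ts].
  move: gij; case gj: (g i (step j x)); case gx: (g i x) => // _.
    by exists x, (step j x); rewrite gj gx.
  by exists (step j x), x; rewrite gj gx.
have [y [y' [by1 by2 gy gy']]] := IH _ _ cs t ts.
have bb z : (forall l, (step j x l <= z l <= step j x l + (l \in A :\ j))%N) ->
    forall l, (x l <= z l <= x l + (l \in A))%N.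
  move=> h l; move: (h l); rewrite ffunE !inE; case: eqP => [->|ne] /=.
    by rewrite jA addn0 addn1 => /andP[/ltnW -> ->].
  by rewrite addn0.
by exists y, y'; split => //; exact: bb.
Qed.

(** The point x with its coordinate j replaced by c. *)
Definition setc (j : 'I_M) c x : lattice := [ffun i => if i == j then c else x i].

Variable k : nat.

(** The sum of F over the points whose coordinates listed in s range over
    0, ..., k - 1, the other coordinates being those of x. *)
Fixpoint boxsum s (F : lattice -> bool) x : bool :=
  if s is j :: s' then \sum_(c < k) boxsum s' F (setc j c x) else F x.

Lemma boxsumD s F G x : boxsum s (fun y => F y + G y) x = boxsum s F x + boxsum s G x.
Proof.
by elim: s x => //= j s IH x; rewrite -big_split /=; apply: eq_bigr => c _; rewrite IH.
Qed.

Lemma boxsum_sum (I : Type) (r : seq I) (P : pred I) s (F : I -> lattice -> bool) x :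
  boxsum s (fun y => \sum_(i <- r | P i) F i y) x =
  \sum_(i <- r | P i) boxsum s (F i) x.
Proof.
elim: s x => //= j s IH x; rewrite exchange_big /=.
by apply: eq_bigr => c _; rewrite IH.
Qed.

Lemma eq_boxsum s F G x : F =1 G -> boxsum s F x = boxsum s G x.
Proof.
by move=> FG; elim: s x => //= j s IH x; apply: eq_bigr => c _; rewrite IH.
Qed.

Lemma boxsum_face s F j a x : j \notin s -> x j = a ->
  (forall y, y j = a -> F y = 0) -> boxsum s F x = 0.
Proof.
move=> + + F0; elim: s x => [|l s IH] x /=; first by move=> _; apply: F0.
rewrite inE negb_or => /andP[jl js] xj; rewrite big1// => c _.
by apply: IH; rewrite // ffunE (negPf jl).
Qed.

Lemma eq_boxsum_face s F G j a x : j \notin s -> x j = a ->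
  (forall y, y j = a -> F y = G y) -> boxsum s F x = boxsum s G x.
Proof.
move=> + + F0; elim: s x => [|l s IH] x /=; first by move=> _; apply: F0.
rewrite inE negb_or => /andP[jl js] xj; apply: eq_bigr => c _.
by apply: IH; rewrite // ffunE (negPf jl).
Qed.

Lemma boxsum_step s F j x : j \notin s ->
  boxsum s (fun y => F (step j y)) x = boxsum s F (step j x).
Proof.
elim: s x => //= l s IH x; rewrite inE negb_or => /andP[jl js].
apply: eq_bigr => c _; rewrite IH//; congr (boxsum _ _ _); apply/ffunP => i.
rewrite !ffunE; case: eqP => [->|//].
by rewrite eq_sym (negPf jl) addn0.
Qed.

(** Telescoping in the direction j leaves the two opposite faces of the box. *)
Lemma boxsum_stokes s F j x : j \notin s ->
  boxsum (j :: s) (fun y => F (step j y) + F y) x =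
  boxsum s F (setc j k x) + boxsum s F (setc j 0 x).
Proof.
move=> js /=; elim: k => [|m IH]; first by rewrite big_ord0 add_self_bool.
rewrite big_ord_recr /= IH boxsumD boxsum_step//.
have -> : step j (setc j m x) = setc j m.+1 x.
  by apply/ffunP => i; rewrite !ffunE; case: eqP; rewrite ?addn1 ?addn0.
rewrite addrC -!addrA; congr (_ + _); by rewrite addrA add_self_bool add0r.
Qed.

(** Same telescoping in any direction of the box, when F vanishes on the two
    faces orthogonal to it. *)
Lemma boxsum_inner s F j x : uniq s -> j \in s ->
  (forall y, y j = 0%N -> F y = 0) -> (forall y, y j = k -> F y = 0) ->
  boxsum s (fun y => F (step j y) + F y) x = 0.
Proof.
move=> + + F0 Fk; elim: s x => // i s IH x; rewrite inE cons_uniq => /andP[iss us].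
have [ji _|ji /= js] := eqVneq j i.
  rewrite -ji in iss *; rewrite boxsum_stokes//.
  by rewrite (boxsum_face _ _ Fk) ?(boxsum_face _ _ F0)// !ffunE eqxx.
by rewrite big1// => c _; exact: IH.
Qed.

Lemma boxsum_neq0 s F x : boxsum s F x -> uniq s ->
  exists y, [/\ F y, forall i, i \notin s -> y i = x i &
                forall i, i \in s -> (y i < k)%N].
Proof.
elim: s x => [|j s IH] x /=; first by move=> Fx _; exists x.
move=> /eqP b1 /andP[js us].
have /existsP[c bc] : [exists c : 'I_k, boxsum s F (setc j c x)].
  apply: contra_eqT b1 => /existsPn h; rewrite big1// => c _.
  by move: (h c) => /negbTE.
have [y [Fy yx yk]] := IH _ bc us.
exists y; split=> // i; rewrite inE.
  by rewrite negb_or => /andP[ij /yx ->]; rewrite ffunE (negPf ij).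
by case/predU1P => [->|/yk//]; rewrite yx// ffunE eqxx.
Qed.

(** By induction on the dimension: of the boundary terms produced by Stokes'
    formula, only the face with coordinate i equal to k survives for the first
    index i of s, and there g i is 1. *)
Lemma boxsum_cup (g : 'I_M -> lattice -> bool) s x :
  (forall i y, y i = 0%N -> g i y = false) ->
  (forall i y, y i = k -> g i y = true) -> uniq s ->
  boxsum s (cup [seq g i | i <- s] [set i in s]) x = 1.
Proof.
move=> g0 gk; elim: s x => // i s IH x; rewrite [map _ _]/= cons_uniq => /andP[iss us].
have uis : uniq (i :: s) by rewrite /= iss.
pose F j y := g i y * cup [seq g l | l <- s] ([set l in i :: s] :\ j) y.
under eq_boxsum => y do rewrite cup_cons ?cobd_cup//.
rewrite boxsum_sum (bigD1 i) ?inE ?eqxx//.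
have Ai : [set l in i :: s] :\ i = [set l in s].
  apply/setP => l; rewrite !inE; case: eqP => // ->.
  by rewrite (negPf iss).
have -> : boxsum (i :: s) (fun y => F i (step i y) + F i y) x = 1.
  rewrite boxsum_stokes// /F Ai [X in _ + X](@boxsum_face _ _ i 0%N)//; first last.
  - by move=> y yi; rewrite g0// mul0r.
  - by rewrite ffunE eqxx.
  rewrite addr0 (@eq_boxsum_face _ _ (cup [seq g i | i <- s] [set i in s]) i k)//.
  - exact: IH.
  - by rewrite ffunE eqxx.
  - by move=> y yi; rewrite gk// mul1r.
rewrite big1 ?addr0// => j; rewrite !inE => /andP[/predU1P[->|js] ji].
  by rewrite eqxx in ji.
apply: (boxsum_inner (F := F j)); rewrite ?inE ?js ?orbT//.
- move=> y yj; rewrite /F (@cup_face _ g s _ _ j 0%N false j) ?mulr0// ?setD11//.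
  by move=> z; exact: g0.
- move=> y yj; rewrite /F (@cup_face _ g s _ _ j k true j) ?mulr0// ?setD11//.
  by move=> z; exact: gk.
Qed.

(** If g i is 0 on the face with coordinate i equal to 0 and 1 on the opposite
    face, then some unit cube of the grid has, for each i, vertices with both
    values of g i. *)
Theorem kuhn_cube (g : 'I_M -> lattice -> bool) :
  (forall i y, y i = 0%N -> g i y = false) ->
  (forall i y, y i = k -> g i y = true) ->
  exists x, (forall i, x i < k)%N /\ forall i, exists y y',
  [/\ forall l, (x l <= y l <= (x l).+1)%N,
      forall l, (x l <= y' l <= (x l).+1)%N, ~~ g i y & g i y'].
Proof.
move=> g0 gk.
have := boxsum_cup [ffun => 0%N] g0 gk (enum_uniq 'I_M).
move=> /eqP; rewrite eqb_id => b1.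
have [x [cx _ xk]] := boxsum_neq0 b1 (enum_uniq 'I_M).
exists x; split => [i|i]; first by apply: xk; rewrite mem_enum.
have [|y [y' [h1 h2 h3 h4]]] := cup_neq0 cx (t := i); first by rewrite mem_enum.
have eA l : (x l + (l \in [set i in enum 'I_M]))%N = (x l).+1.
  by rewrite inE mem_enum addn1.
by exists y, y'; split => // l; rewrite -eA.
Qed.
End KuhnLemma.

Local Open Scope classical_set_scope.

(** * The Fan-Browder fixed point theorem *)

Lemma convex_setP (R : realType) (V : lmodType R) (A : set V) :
  convex_set A <->
  forall x y t, A x -> A y -> 0 <= t <= 1 -> A (t *: x + (1 - t) *: y).
Proof.
split=> [cA x y t Ax Ay /andP[t0 t1]|cA x y l].
  by have := cA x y (Itv01 t0 t1); rewrite !inE; apply.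
rewrite !inE => Ax Ay; apply: cA => //.
by rewrite ge0/= le1.
Qed.

(** The balls of radii r a centred in X have a finite subcover, whose radii are
    bounded below by some e > 0. *)
Lemma compact_ball_cover (R : realType) (V : normedModType R) (X : set V)
    (r : V -> R) : compact X -> (forall a, X a -> 0 < r a) ->
  exists (s : seq V) (e : R), [/\ 0 < e,
    forall a, a \in s -> X a /\ e <= r a &
    forall x, X x -> exists2 a, a \in s & `|x - a| < r a].
Proof.
rewrite compact_cover => cX r0.
have [||D DX Xs] := cX _ X (fun a => ball a (r a)).
- by move=> a Xa; exact: ball_open.
- by move=> a Xa; exists a => //; apply: ballxx; exact: r0.
set s := finmap.enum_fset D.
have {}DX a : a \in s -> X a by move=> aD; move: (DX a aD); rewrite inE.
have [e [e0 he]] : exists e, 0 < e /\ forall a, a \in s -> e <= r a.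
  elim: s DX => [|b s IH] sX; first by exists 1.
  have [a sa|e [e0 he]] := IH; first by apply: sX; rewrite inE sa orbT.
  exists (Num.min e (r b)); split.
    by rewrite lt_min e0 r0//; apply: sX; rewrite inE eqxx.
  by move=> a; rewrite inE ge_min => /predU1P[->|/he ->//]; rewrite lexx orbT.
exists s, e; split => //.
  by move=> a aD; split; [exact: DX|exact: he].
move=> x /Xs[a aD]; rewrite -ball_normE /= => h; exists a => //.
by rewrite distrC.
Qed.

Section IteratedCombination.
Variables (R : realType) (V : normedModType R) (T : eqType).
Implicit Types (u v : T -> R) (Y : T -> V) (s : seq T) (x : V) (P : set V).

(** Starting from x, move successively towards the points Y j, by the fraction
    u j of the way.  Unlike barycentric coordinates, the u j are independent of
    each other, so that they range over a cube. *)
Definition stick u Y s x : V :=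
  foldl (fun x j => u j *: Y j + (1 - u j) *: x) x s.

Lemma stick_in P u Y s x : convex_set P -> (forall j, 0 <= u j <= 1) ->
  (forall j, j \in s -> P (Y j)) -> P x -> P (stick u Y s x).
Proof.
move=> /convex_setP cP u01; elim: s x => //= j s IH x PY Px.
apply: IH => [i si|]; first by apply: PY; rewrite inE si orbT.
by apply: cP => //; apply: PY; rewrite inE eqxx.
Qed.

(** Only the points Y j with u j > 0 matter, and the starting point is forgotten
    as soon as some u j equals 1. *)
Lemma stick_in_supp P u Y s x : convex_set P -> (forall j, 0 <= u j <= 1) ->
  (forall j, j \in s -> 0 < u j -> P (Y j)) ->
  P x \/ (exists2 j, j \in s & u j = 1) -> P (stick u Y s x).
Proof.
move=> /convex_setP cP u01; elim: s x => [|j s IH] x PY.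
  by case=> // -[].
move=> H /=; apply: IH => [i si|]; first by apply: PY; rewrite inE si orbT.
have PYj : 0 < u j -> P (Y j) by apply: PY; rewrite inE eqxx.
have case1 : u j = 1 -> P (u j *: Y j + (1 - u j) *: x).
  by move=> uj; rewrite uj subrr scale0r addr0 scale1r; apply: PYj; rewrite uj.
case: H => [Px|[i]]; last first.
  rewrite inE => /predU1P[-> /case1|]; first by left.
  by move=> si ui; right; exists i.
left; have /andP[] := u01 j; rewrite le_eqVlt => /predU1P[<- _|uj0 uj1].
  by rewrite scale0r add0r subr0 scale1r.
by apply: cP; [exact: PYj| |rewrite ltW].
Qed.

Lemma stick_lipschitz P B d u v Y s x x' : convex_set P ->
  (forall y, P y -> `|y| <= B) ->
  (forall j, 0 <= u j <= 1) -> (forall j, 0 <= v j <= 1) ->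
  (forall j, `|u j - v j| <= d) ->
  (forall j, j \in s -> P (Y j)) -> P x' ->
  `|stick u Y s x - stick v Y s x'| <= `|x - x'| + (size s)%:R * (d * (B + B)).
Proof.
move=> /[dup] cP0 /convex_setP cP PB u01 v01 uv.
elim: s x x' => [|j s IH] x x' PY Px' /=; first by rewrite mul0r addr0.
have PYj : P (Y j) by apply: PY; rewrite inE eqxx.
apply: le_trans (IH _ _ _ _) _.
- by move=> i si; apply: PY; rewrite inE si orbT.
- exact: cP.
have -> : u j *: Y j + (1 - u j) *: x - (v j *: Y j + (1 - v j) *: x') =
    (1 - u j) *: (x - x') + (u j - v j) *: (Y j - x').
  rewrite -(subrKA (u j *: Y j + (1 - u j) *: x')) !opprD; congr (_ + _).
    by rewrite addrACA subrr add0r -scalerBr.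
  rewrite addrACA -!scalerBl (_ : 1 - u j - (1 - v j) = - (u j - v j)); last by ring.
  by rewrite scaleNr -scalerBr.
rewrite -natr1 mulrDl mul1r addrA [leRHS]addrAC lerD2r.
apply: le_trans (ler_normD _ _) _; rewrite !normrZ; apply: lerD.
  have /andP[u0 u1] := u01 j.
  by rewrite ger0_norm ?subr_ge0// ler_piMl// lerBlDl lerDr.
apply: ler_pM => //.
by apply: le_trans (ler_normB _ _) _; apply: lerD; exact: PB.
Qed.
End IteratedCombination.

(** The Fan-Browder fixed point theorem.  The last hypothesis holds if Phi has
    nonempty values in X and inverse images open in X. *)
Theorem fan_browder (R : realType) (V : normedModType R) (X : set V)
    (Phi : V -> set V) : compact X -> convex_set X -> X !=set0 ->
  (forall b, X b -> convex_set (Phi b)) ->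
  (forall a, X a -> exists2 y, X y & \forall b \near a, X b -> Phi b y) ->
  exists2 b, X b & Phi b b.
Proof.
move=> cptX cX [x0 Xx0] cPhi sel.
have /choice[y_ Hy] : forall a, exists y, X a -> X y /\
    \forall b \near a, X b -> Phi b y.
  by move=> a; have [/sel[y]|] := pselect (X a); [exists y|exists 0].
have /choice[r_ Hr] : forall a, exists r, X a -> 0 < r /\
    forall b, `|b - a| < 3 * r -> X b -> Phi b (y_ a).
  move=> a; have [Xa|] := pselect (X a); last by exists 0.
  have [_ /nbhs_ballP[e /= e0 he]] := Hy a Xa.
  exists (e / 3) => _; split=> [|b]; first by rewrite divr_gt0.
  have -> : 3 * (e / 3) = e by field.
  by move=> ba; apply: he; rewrite -ball_normE /= distrC.
(* The balls of radius r cover X, the labels below use radius 2 r, and the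
   selections are valid on radius 3 r; e is a margin below every r. *)
have [s [e [e0 sX scov]]] := compact_ball_cover cptX (fun a Xa => (Hr a Xa).1).
have [B HB] : exists B, forall y, X y -> `|y| <= B.
  have [B [_ HB]] := compact_bounded cptX.
  exists (B + 1) => y Xy; apply: (HB (B + 1)) => //.
  by rewrite ltrDl.
have B0 : 0 <= B by apply: le_trans (HB _ Xx0).
pose M := size s.
pose a_ (j : 'I_M) := tnth (in_tuple s) j.
have as_ j : a_ j \in s by exact: mem_tnth.
pose m := (Num.bound (M%:R * (B + B) / e)).+1.
have m0 : 0 < m%:R :> R by rewrite ltr0n.
have mB : M%:R * ((m%:R)^-1 * (B + B)) < e.
  rewrite mulrCA mulrC ltr_pdivrMr// -ltr_pdivrMl// mulrC.
  apply: lt_le_trans (archi_boundP _) _.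
    by rewrite divr_ge0 ?mulr_ge0 ?addr_ge0// ltW.
  by rewrite ler_nat leqnSn.
(* The grid has side m + 1 but the weights already reach 1 at m, so that the
   lowest vertex of a cube touching the upper face has weight 1. *)
pose u (z : {ffun 'I_M -> nat}) j : R := (minn (z j) m)%:R / m%:R.
have u01 z j : 0 <= u z j <= 1.
  by rewrite divr_ge0 //= ler_pdivrMr// mul1r ler_nat geq_minr.
have u_lip (v z : {ffun 'I_M -> nat}) j :
    (v j <= z j <= (v j).+1)%N -> `|u z j - u v j| <= m%:R^-1.
  move=> /andP[vz zv]; rewrite /u -mulrBl normrM [X in _ * X]ger0_norm ?invr_ge0//.
  rewrite ler_piMl ?invr_ge0// ger0_norm; last first.
    by rewrite subr_ge0 ler_nat leq_min geq_minr andbT (leq_trans (geq_minl _ _)).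
  rewrite lerBlDl natr1 ler_nat.
  clearbody m; lia.
pose xx z := stick (u z) (fun j => y_ (a_ j)) (enum 'I_M) x0.
have Ya j : X (y_ (a_ j)) by apply: (Hy _ _).1; exact: (sX _ (as_ j)).1.
have Xxx z : X (xx z) by apply: stick_in.
have xx_lip (v z : {ffun 'I_M -> nat}) :
    (forall j, v j <= z j <= (v j).+1)%N -> `|xx z - xx v| < e.
  move=> vz; apply: le_lt_trans mB.
  have := @stick_lipschitz R V _ X B m%:R^-1 (u z) (u v) (fun j => y_ (a_ j))
    (enum 'I_M) x0 x0 cX HB (u01 z) (u01 v) (fun j => u_lip v z j (vz j))
    (fun j _ => Ya j) Xx0.
  by rewrite subrr normr0 add0r size_enum_ord.
pose g (j : 'I_M) (z : {ffun 'I_M -> nat}) : bool :=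
  (z j == m.+1) || (z j != 0%N) && ~~ `[< `|xx z - a_ j| < 2 * r_ (a_ j) >].
(* v is the lowest vertex of a cube on which no label is constant; its image
   is the fixed point. *)
have [||v [vm Hv]] := @kuhn_cube M m.+1 g.
- by move=> j z; rewrite /g => ->.
- by move=> j z; rewrite /g => ->; rewrite eqxx.
exists (xx v) => //; apply: stick_in_supp => //.
- exact: cPhi.
(* A positive weight at v excludes the face y j = 0, so label 0 means that the
   image of y is within 2 r of a_ j. *)
- move=> j _ uj.
  have [y [_ [vy _ /norP[_ gy] _]]] := Hv j.
  have [_ erj] := sX _ (as_ j).
  have [rj0 HPhi] := Hr _ (sX _ (as_ j)).1.
  apply: HPhi => //.
  have vj0 : (0 < v j)%N.
    rewrite lt0n; apply: contraTneq uj => vj0.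
    by rewrite /u vj0 min0n mul0r ltxx.
  have yj0 : y j != 0%N by rewrite -lt0n (leq_trans vj0)//; have /andP[] := vy j.
  move: gy; rewrite yj0 /= negbK => /asboolP ya.
  have := xx_lip _ _ vy; rewrite distrC => vy'.
  have := ler_distD (xx y) (xx v) (a_ j).
  lra.
(* For a ball of radius r containing the image of v, label 1 can only come from
   the face y' j = m + 1. *)
- right; have [a /(nthP 0)[i si <-] xa] := scov _ (Xxx v).
  pose j : 'I_M := Ordinal si.
  have aj : a_ j = nth 0 s i by rewrite /a_ (tnth_nth 0).
  exists j; rewrite ?mem_enum//.
  have [_ [y' [_ vy _ gy]]] := Hv j.
  have [_ erj] := sX _ (as_ j).
  rewrite -aj in xa.
  have := xx_lip _ _ vy => vy'.
  have := ler_distD (xx v) (xx y') (a_ j) => tri.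
  have ya : `|xx y' - a_ j| < 2 * r_ (a_ j) by lra.
  move: gy; rewrite /g; rewrite (asboolT ya) andbF orbF => /eqP y'm.
  have /andP[_] := vy j; rewrite y'm ltnS => mv.
  by rewrite /u (minn_idPr mv) divff// gt_eqF.
Qed.

Lemma cvg_sum_fin (R : realType) (T : Type) (F : set_system T)
    (I : finType) (f : I -> T -> R) (l : I -> R) : Filter F ->
  (forall i, f i x @[x --> F] --> l i) ->
  \sum_i f i x @[x --> F] --> \sum_i l i.
Proof.
move=> FF h.
by apply: (@cvg_big R^o I +%R 0 xpredT (@add_continuous R^o) T F) => i _; exact: h.
Qed.

(** * Euclidean geometry *)

Section Euclidean.
Variables (R : realType) (n : nat).
Implicit Types (x y z p : 'rV[R]_n).

(** The Euclidean inner product. *)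
Definition dot x y : R := \sum_(i < n) x 0 i * y 0 i.

Lemma dotC x y : dot x y = dot y x.
Proof. by apply: eq_bigr => i _; rewrite mulrC. Qed.

Lemma dotDr p x y : dot p (x + y) = dot p x + dot p y.
Proof. by rewrite /dot -big_split; apply: eq_bigr => i _; rewrite mxE mulrDr. Qed.

Lemma dotZr p t x : dot p (t *: x) = t * dot p x.
Proof. by rewrite /dot mulr_sumr; apply: eq_bigr => i _; rewrite mxE mulrCA. Qed.

Lemma dotBr p x y : dot p (x - y) = dot p x - dot p y.
Proof. by rewrite dotDr -scaleN1r dotZr mulN1r. Qed.

Lemma dotDl p x y : dot (x + y) p = dot x p + dot y p.
Proof. by rewrite !(dotC _ p) dotDr. Qed.

Lemma dotZl p t x : dot (t *: x) p = t * dot x p.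
Proof. by rewrite !(dotC _ p) dotZr. Qed.

Lemma dot_ge0 x : 0 <= dot x x.
Proof. by apply: sumr_ge0 => i _; rewrite -expr2 sqr_ge0. Qed.

Lemma dot_eq0 x : dot x x = 0 -> x = 0.
Proof.
move=> /eqP; rewrite psumr_eq0 => [|i _]; last by rewrite -expr2 sqr_ge0.
move=> /allP h; apply/rowP => i; rewrite mxE; apply/eqP.
by have := h i (mem_index_enum i); rewrite /= mulf_eq0 orbb.
Qed.

Lemma dot_convex x y t : dot (t *: x + (1 - t) *: y) (t *: x + (1 - t) *: y) =
  t * dot x x + (1 - t) * dot y y - t * (1 - t) * dot (x - y) (x - y).
Proof.
rewrite -[- y]scaleN1r !(dotDr, dotDl, dotZr, dotZl) (dotC y x); ring.
Qed.

Lemma enormE x : enorm x = Num.sqrt (dot x x).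
Proof. by congr Num.sqrt; apply: eq_bigr => i _; rewrite expr2. Qed.

Lemma cballE (rho : R) : 0 <= rho ->
  cball rho = [set x : 'rV[R]_n | dot x x <= rho ^+ 2].
Proof.
move=> r0; apply/seteqP; split => x /=; rewrite /cball /= enormE.
  by move=> h; rewrite -(sqr_sqrtr (dot_ge0 x)) ler_pXn2r// nnegrE sqrtr_ge0.
by move=> h; rewrite -(ger0_norm r0) -sqrtr_sqr ler_wsqrtr.
Qed.

Lemma continuous_dot p : continuous (dot p).
Proof.
rewrite /dot => y; apply: (@cvg_sum_fin R _ (nbhs y)) => i.
apply: (@cvgM _ _ (nbhs y) _ (fun=> p 0 i) (fun x => x 0 i)).
  exact: cvg_cst.
exact: coord_continuous.
Qed.

Lemma continuous_sqdot c : continuous (fun x => dot (x - c) (x - c)).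
Proof.
rewrite /dot => x; apply: (@cvg_sum_fin R _ (nbhs x)) => i.
have h : (fun y : 'rV[R]_n => (y - c) 0 i) @ x --> (x - c) 0 i.
  have -> : (fun y : 'rV[R]_n => (y - c) 0 i) = (fun y => y 0 i - c 0 i).
    by apply/funext => y; rewrite !mxE.
  rewrite mxE [(- c) 0 i]mxE.
  apply: (@cvgB _ R^o _ (nbhs x) _ (fun y : 'rV[R]_n => y 0 i) (fun=> c 0 i)).
    exact: coord_continuous.
  exact: cvg_cst.
by apply: cvgM; exact: h.
Qed.

Lemma closed_cball (rho : R) : 0 <= rho -> closed (cball rho : set 'rV[R]_n).
Proof.
move=> r0; rewrite cballE//.
have -> : [set x : 'rV[R]_n | dot x x <= rho ^+ 2] =
    (fun x => dot (x - 0) (x - 0)) @^-1` [set t | t <= rho ^+ 2].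
  by apply/seteqP; split => x /=; rewrite subr0.
apply: preimage_closed; first by move=> x _; exact: continuous_sqdot.
exact: closed_le.
Qed.

Lemma compact_cball (rho : R) : 0 <= rho -> compact (cball rho : set 'rV[R]_n).
Proof.
move=> r0; apply: bounded_closed_compact; last exact: closed_cball.
exists rho; split; first exact: num_real.
move=> M rM x; rewrite cballE//= => xr.
have M0 : 0 <= M by rewrite (le_trans r0)// ltW.
rewrite [`|x|]mx_normrE; apply/bigmax_leP; split => // -[i j] _.
rewrite /= ord1 -sqrtr_sqr -[M]ger0_norm//.
rewrite -sqrtr_sqr ler_wsqrtr//.
apply: (@le_trans _ _ (rho ^+ 2)); last by rewrite ler_pXn2r ?nnegrE// ltW.
apply: le_trans xr; rewrite /dot (bigD1 j)//= expr2 lerDl.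
by apply: sumr_ge0 => l _; rewrite -expr2 sqr_ge0.
Qed.

Lemma convex_cball (rho : R) : 0 <= rho -> convex_set (cball rho : set 'rV[R]_n).
Proof.
move=> r0; rewrite cballE//; apply/convex_setP => x y t /= xr yr /andP[t0 t1].
rewrite dot_convex.
have : 0 <= t * (1 - t) * dot (x - y) (x - y) by rewrite !mulr_ge0 ?subr_ge0// dot_ge0.
nra.
Qed.

(** The separating form is the difference of x and its nearest point in A. *)
Lemma convex_separation (A : set 'rV[R]_n) x : compact A -> convex_set A ->
  ~ A x -> exists p, forall y, A y -> dot p (y - x) < 0.
Proof.
move=> cA /convex_setP cvA nAx.
have [A0|/set0P A0] := eqVneq A set0.
  by exists 0 => y; rewrite A0.
have [y0 + ymin] := compact_EVT_min A0 cA
  (continuous_subspaceT (continuous_sqdot (c := x))).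
rewrite inE => Ay0.
pose p := x - y0; exists p => y Ay.
have p0 : 0 < dot p p.
  rewrite lt_def dot_ge0 andbT; apply: contra_notN nAx => /eqP/dot_eq0/eqP.
  by rewrite subr_eq0 => /eqP ->.
(* Minimality of y0 on the segment from y0 to y, then t tends to 0. *)
have key t : 0 <= t <= 1 -> 0 <= t * (dot (y - x) (y - x) - dot p p) -
    t * (1 - t) * dot (y - y0) (y - y0).
  move=> t01; have := ymin (t *: y + (1 - t) *: y0).
  rewrite inE => /(_ (cvA _ _ _ Ay Ay0 t01)).
  have -> : t *: y + (1 - t) *: y0 - x = t *: (y - x) + (1 - t) *: (y0 - x).
    by rewrite !scalerBr addrACA -opprD -scalerDl subrKC scale1r.
  rewrite dot_convex.
  have -> : y - x - (y0 - x) = y - y0 by rewrite opprB addrA subrK.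
  have -> : dot (y0 - x) (y0 - x) = dot p p.
    by rewrite -opprB -scaleN1r dotZl dotZr mulN1r mulN1r opprK.
  lra.
have far : dot (y - y0) (y - y0) <= dot (y - x) (y - x) - dot p p.
  set c := dot (y - y0) _ in key *; set d := _ - _ in key *.
  rewrite leNgt; apply/negP => dc.
  have c0 : 0 <= c by exact: dot_ge0.
  have d0 : 0 <= d.
    by have := key 1; rewrite ler01 lexx subrr mulr0 mul0r subr0 mul1r; apply.
  have cp : 0 < c by exact: le_lt_trans dc.
  have t01 : 0 <= (c - d) / (2 * c) <= 1.
    rewrite divr_ge0 ?mulr_ge0//; last by rewrite subr_ge0 ltW.
    by rewrite ler_pdivrMr ?mulr_gt0//; lra.
  have tp : 0 < (c - d) / (2 * c) by rewrite divr_gt0 ?mulr_gt0 ?subr_gt0.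
  have := key _ t01.
  have -> : (c - d) / (2 * c) * d - (c - d) / (2 * c) * (1 - (c - d) / (2 * c)) * c
     = (c - d) / (2 * c) * ((d - c) / 2) by field; lra.
  rewrite pmulr_rge0//; lra.
have yy0 : y - y0 = (y - x) + p by rewrite /p addrA subrK.
move: far; rewrite yy0; clearbody p; move: (y - x) => z.
rewrite !(dotDr, dotDl) (dotC z p); lra.
Qed.

End Euclidean.

(** * Quasi-equilibria on a compact convex set *)

Lemma near_all_seq (T : topologicalType) (I : eqType) (s : seq I)
    (P : I -> T -> Prop) (x : T) :
  (forall i, i \in s -> \forall y \near x, P i y) ->
  \forall y \near x, forall i, i \in s -> P i y.
Proof.
elim: s => [|j s IH] h; first by near=> y.
have hj := h j (mem_head _ _).
have hs : \forall y \near x, forall i, i \in s -> P i y.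
  by apply: IH => i si; apply: h; rewrite inE si orbT.
near=> y => i; rewrite inE => /predU1P[->|si]; first by near: y.
by move: i si; near: y.
Unshelve. all: by end_near. Qed.

(** Strict separation of x from S x persists near x when S has a closed graph
    in a compact set. *)
Lemma separation_near (R : realType) n (X : set 'rV[R]_n)
    (S : 'rV[R]_n -> set 'rV[R]_n) (x p : 'rV[R]_n) :
  compact X -> (forall b, X b -> S b `<=` X) ->
  closed [set q | X q.1 /\ S q.1 q.2] ->
  X x -> (forall y, S x y -> dot p (y - x) < 0) ->
  \forall b \near x, X b -> forall y, S b y -> dot p (y - b) < 0.
Proof.
move=> /compact_near_coveringP/near_covering_withinP cX SX clS Xx sep.
suff : \forall b \near x, X `<=` [set y | X b -> S b y -> dot p (y - b) < 0].
  move=> h; near=> b => Xb y Sby.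
  by apply: (near h b); rewrite //; exact: SX Sby.
apply: (cX _ (nbhs x) (fun b y => X b -> S b y -> dot p (y - b) < 0)) => y Xy.
have [Sxy|nSxy] := pselect (S x y).
  have hy : \forall z \near y & b \near x, dot p (z - b) < 0.
    have h : (fun q : 'rV[R]_n * 'rV[R]_n => dot p (q.1 - q.2)) @ (y, x) -->
        dot p (y - x).
      apply: (@continuous_comp _ _ _
        (fun q : 'rV[R]_n * 'rV[R]_n => q.1 - q.2) (dot p) (y, x)).
        by apply: cvgB; [exact: cvg_fst|exact: cvg_snd].
      exact: continuous_dot.
    exact: (cvgr_lt _ h _ (sep _ Sxy)).
  by apply: filterS hy => -[z b] /= h _ _ _; exact: h.
have : \forall q \near (x, y), ~ (X q.1 /\ S q.1 q.2).
  have := closed_openC clS; rewrite openE => /(_ (x, y)); apply => -[] //.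
move=> [[U W] [/= xU yW] UW].
exists (W, U) => //= -[z b] [/= Wz Ub] _ Xb Sbz.
by case: (UW (b, z)).
Unshelve. all: by end_near. Qed.

(** F x is to be thought of as the set of points strictly preferred to x, and U
    traces on X the set of x for which S x contains such a point. *)
Theorem compact_quasi_equilibrium (R : realType) n (X U : set 'rV[R]_n)
    (S F : 'rV[R]_n -> set 'rV[R]_n) :
  compact X -> convex_set X -> X !=set0 ->
  (forall x, X x -> S x `<=` X) ->
  (forall x, X x -> S x !=set0) ->
  (forall x, X x -> convex_set (S x)) ->
  closed [set q | X q.1 /\ S q.1 q.2] ->
  (forall x, X x -> convex_set (F x)) ->
  (forall x, X x -> ~ F x x) ->
  (forall x y, X x -> X y -> F x y -> \forall b \near x, X b -> F b y) ->
  open U -> (forall x, X x -> U x <-> S x `&` F x !=set0) ->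
  exists x, [/\ X x, S x x & S x `&` F x = set0].
Proof.
move=> cX cvX X0 SX S0 cvS clS cvF nF lF oU US.
apply/not_existsP => H.
have HU x : X x -> S x x -> U x.
  move=> Xx Sxx; apply: contrapT => nU; apply: (H x); split => //.
  by apply: contra_notP nU => /eqP/set0P; exact: (US x Xx).2.
have clX : closed X by apply: compact_closed => //; exact: norm_hausdorff.
pose Z := X `&` ~` U.
have cZ : compact Z.
  apply: (subclosed_compact _ cX); last by move=> z [].
  by apply: closedI => //; exact: open_closedC.
have cS x : X x -> compact (S x).
  move=> Xx; apply: (subclosed_compact _ cX); last exact: SX.
  have -> : S x = (fun y => (x, y)) @^-1` [set q | X q.1 /\ S q.1 q.2].
    by apply/seteqP; split => y //= [].
  apply: preimage_closed => // y _.
  exact: (cvg_pair (cvg_cst x) (@cvg_id _ (nbhs y))).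
have /choice[p_ Hp] : forall z, exists p, Z z ->
    \forall b \near z, X b -> forall y, S b y -> dot p (y - b) < 0.
  move=> z; have [[Xz nUz]|] := pselect (Z z); last by exists 0.
  have [|p Hp] := convex_separation (cS z Xz) (cvS z Xz) (x := z).
    by move=> /(HU _ Xz).
  by exists p => _; exact: separation_near Hp.
have /choice[r_ Hr] : forall z, exists r : R, Z z -> 0 < r /\
    forall b, `|b - z| < 2 * r -> X b -> forall y, S b y -> dot (p_ z) (y - b) < 0.
  move=> z; have [Zz|] := pselect (Z z); last by exists 0.
  have /nbhs_ballP[e /= e0 he] := Hp z Zz.
  exists (e / 2) => _; split=> [|b]; first by rewrite divr_gt0.
  have -> : 2 * (e / 2) = e by field.
  by move=> ba; apply: he; rewrite -ball_normE /= distrC.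
have [s [e [e0 sZ scov]]] := compact_ball_cover cZ (fun a Za => (Hr a Za).1).
(* Each closed ball of radius r imposes its linear form, and the strict
   preference is imposed outside all the open balls.  Both kinds of condition
   hold on closed sets of b, hence the open inverse images of Phi. *)
pose Phi b : set 'rV[R]_n := [set y | [/\ X y,
   (forall a, a \in s -> r_ a <= `|b - a|) -> F b y &
   forall a, a \in s -> `|b - a| <= r_ a -> dot (p_ a) (y - b) < 0]].
have cnorm (a x : 'rV[R]_n) : (fun b => `|b - a|) @ x --> `|x - a|.
  exact: (cvg_norm (cvgB (@cvg_id _ (nbhs x)) (cvg_cst a))).
have [||b Xb [_ Fb pb]] := @fan_browder R _ X Phi cX cvX X0.
- move=> b Xb; apply/convex_setP => x y t [Xx Fx px] [Xy Fy py] t01.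
  have /andP[t0 t1] := t01.
  split.
  + by move/convex_setP: cvX; apply.
  + by move=> h; move/convex_setP: (cvF b Xb); apply; [exact: Fx|exact: Fy|].
  + move=> a sa ba.
    have := px a sa ba; have := py a sa ba.
    rewrite !dotBr dotDr !dotZr => yb xb.
    have [t00|tn0] := eqVneq t 0; first by rewrite t00; lra.
    have tb : t * (dot (p_ a) x - dot (p_ a) b) < 0.
      by rewrite pmulr_rlt0// lt_def tn0.
    have : (1 - t) * (dot (p_ a) y - dot (p_ a) b) <= 0.
      by rewrite mulr_ge0_le0 ?subr_ge0// ltW.
    lra.
- move=> a0 Xa0.
  have [y [Say Phiy]] : exists y, S a0 y /\ Phi a0 y.
    have Sp y : S a0 y -> forall a, a \in s -> `|a0 - a| <= r_ a ->
        dot (p_ a) (y - a0) < 0.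
      move=> Sy a sa a0a; have [r0 hr] := Hr a (sZ a sa).1.
      by apply: hr => //; apply: le_lt_trans a0a _; lra.
    have [/(US _ Xa0)[y [Sy Fy]]|nU] := pselect (U a0).
      by exists y; split => //; split => //; [exact: SX Sy|exact: Sp].
    have [y Sy] := S0 _ Xa0.
    have [//|a sa ha] := scov a0.
    exists y; split => //; split; [exact: SX Sy| |exact: Sp].
    by move=> /(_ a sa); rewrite leNgt ha.
  have [Xy Fy py] := Phiy; exists y => //.
  have N1 : \forall b \near a0, X b ->
      (forall a, a \in s -> r_ a <= `|b - a|) -> F b y.
    have [h|] := pselect (forall a, a \in s -> r_ a <= `|a0 - a|).
      have := lF _ _ Xa0 Xy (Fy h); apply: filterS => b h1 Xb _; exact: h1.
    move=> /existsNP[a /not_implyP[sa /negP]]; rewrite -ltNge => ha.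
    have near_a : \forall b \near a0, `|b - a| < r_ a.
      by exact: (cvgr_lt _ (cnorm a a0)).
    by apply: filterS near_a => b hb _ /(_ a sa); rewrite leNgt hb.
  have N2 : \forall b \near a0, forall a, a \in s -> `|b - a| <= r_ a ->
      dot (p_ a) (y - b) < 0.
    apply: near_all_seq => a sa.
    have [h|h] := leP (`|a0 - a|) (r_ a).
      have : (fun b => dot (p_ a) (y - b)) @ a0 --> dot (p_ a) (y - a0).
        have yb : (fun b => y - b) @ a0 --> y - a0.
          exact: (cvgB (cvg_cst y) (@cvg_id _ (nbhs a0))).
        exact: (cvg_comp _ _ yb (@continuous_dot _ _ (p_ a) (y - a0))).
      by move=> /cvgr_lt/(_ _ (py a sa h)); apply: filterS => b hb _.
    have near_a : \forall b \near a0, r_ a < `|b - a|.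
      by exact: (cvgr_gt _ (cnorm a a0)).
    by apply: filterS near_a => b hb; rewrite leNgt hb.
  near=> b => Xb; split => //; [exact: (near N1 b)|exact: (near N2 b)].
have [h|] := pselect (forall a, a \in s -> r_ a <= `|b - a|).
  by apply: (nF b Xb); exact: Fb.
move=> /existsNP[a /not_implyP[sa /negP]]; rewrite -ltNge => /ltW /(pb a sa).
by rewrite dotBr subrr ltxx.
Unshelve. all: by end_near. Qed.

(** * From the ball to the whole constraint set *)

Lemma segment_meets_cball (R : realType) n (rho : R) (x y : 'rV[R]_n) :
  0 < rho -> enorm x < rho ->
  exists2 t, 0 < t < 1 & cball rho (t *: x + (1 - t) *: y).
Proof.
move=> r0 xr.
have xr2 : dot x x < rho ^+ 2.
  have ex0 : 0 <= enorm x by rewrite enormE sqrtr_ge0.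
  by rewrite -(sqr_sqrtr (dot_ge0 x)) -enormE ltr_pXn2r// nnegrE ltW.
pose d := rho ^+ 2 - dot x x.
pose c := dot y y + d.
have d0 : 0 < d by rewrite subr_gt0.
have y0 := dot_ge0 y.
have c0 : 0 < c by rewrite ltr_wpDl.
(* The squared norm at weight s on y is at most
   dot x x + s * (dot y y), and s is small enough to stay below rho ^+ 2. *)
pose s := d / (2 * c).
have sc : s * c = d / 2 by rewrite /s; field; lra.
have s0 : 0 < s by rewrite divr_gt0 ?mulr_gt0.
have s1 : s < 1 by rewrite ltr_pdivrMr ?mulr_gt0//; rewrite /c; lra.
exists (1 - s); first by lra.
rewrite cballE ?ltW//= dot_convex.
have : 0 <= (1 - s) * (1 - (1 - s)) * dot (x - y) (x - y).
  by rewrite !mulr_ge0 ?dot_ge0//; lra.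
move: sc; rewrite /c /d.
have := dot_ge0 x.
nra.
Qed.

Theorem theorem3p5 (R : realType) (n : nat) (C : set 'rV[R]_n)
    (K : 'rV[R]_n -> set 'rV[R]_n) (f : 'rV[R]_n -> 'rV[R]_n -> R) (rho : R)
    (C_convex : convex_set C) (C_closed : closed C) (C_nonempty : C !=set0)
    (K_C : forall x, C x -> K x `<=` C)
    (rho_gt0 : 0 < rho) (f_K_UCC : UCC C K f rho)
    (K_closed : closed_setmap C K)
    (K_convex : forall x, C x -> convex_set (K x))
    (K_nonempty : forall x, C x -> K x !=set0)
    (f_usc : forall y, C y -> upper_semicontinuous (fun x => f x y))
    (f_quasiconvex : forall x, C x -> quasiconvex (f x))
    (D_open : open (negative_inf_set C K f rho
                     : set (subspace (C `&` cball rho))))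
    (f_diag : forall x, C x -> f x x = 0)
    (f_strict : forall x y z, Fix C K x -> f x y <= 0 -> f x z < 0 ->
       forall t : R, 0 < t < 1 -> f x (t *: y + (1 - t) *: z) < 0) :
  exists x0 : 'rV[R]_n,
    [/\ C x0, K x0 x0 & forall y, K x0 y -> 0 <= f x0 y].
Proof.
have [K_ball K_coercive] := f_K_UCC.
have rho_ge0 : 0 <= rho by exact: ltW.
have /convex_setP cball_convex := @convex_cball R n rho rho_ge0.
have oc : (oball rho : set 'rV[R]_n) `<=` cball rho by move=> x; exact: ltW.
pose X := C `&` cball rho.
pose S x := K x `&` cball rho.
pose F x := [set y | f x y < 0].
have [V Vopen VX] := (open_subspaceP X (negative_inf_set C K f rho)).1 D_open.
have VD x : X x -> V x <-> S x `&` F x !=set0.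
  move=> Xx; have -> : V x <-> (V `&` X) x by split=> [|[]].
  rewrite VX; split.
    move=> [[_ /ereal_inf_ltP[_ [y Sy <-] fy]] _]; rewrite lte_fin in fy.
    by exists y.
  move=> [y [Sy fy]]; split => //; split => //.
  by apply/ereal_inf_ltP; exists (f x y)%:E; [exists y|rewrite lte_fin].
have X0 : X !=set0.
  have [c Cc] := C_nonempty; have [y [Kcy yr]] := K_ball c Cc.
  by exists y; split; [exact: K_C Kcy|exact: oc].
have graph_closed : closed (graph C K).
  have CC : closed (C `*` C).
    have -> : C `*` C = (fst @^-1` C) `&` (snd @^-1` C) by [].
    by apply: closedI; apply: preimage_closed => // x _;
      [exact: cvg_fst|exact: cvg_snd].
  have <- : graph C K `&` (C `*` C) = graph C K.
    apply/setIidl => -[x y] [/= Cx Kxy]; split => //; exact: K_C Kxy.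
  by rewrite (closed_setIS _ CC).
have [||||||||||||x [[Cx xr] [Kxx _] SF0]] :=
  @compact_quasi_equilibrium R n X V S F.
- apply: (@subclosed_compact _ X (cball rho)); [|exact: compact_cball|by move=> x []].
  by apply: closedI => //; exact: closed_cball.
- apply/convex_setP => x y t [Cx xr] [Cy yr] t01; split.
    by move/convex_setP: C_convex; apply.
  exact: cball_convex.
- exact: X0.
- by move=> x [Cx _] y [Kxy yr]; split => //; exact: K_C Kxy.
- by move=> x [Cx _]; have [y [Ky /oc yr]] := K_ball x Cx; exists y.
- move=> x [Cx _]; apply/convex_setP => y z t [Ky yr] [Kz zr] t01; split.
    by move/convex_setP: (K_convex x Cx); apply.
  exact: cball_convex.
- have -> : [set q | X q.1 /\ S q.1 q.2] =
      graph C K `&` ((fst @^-1` cball rho) `&` (snd @^-1` cball rho)).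
    by apply/seteqP; split => -[x y] /= [[? ?] [? ?]].
  have cball_closed := @closed_cball R n rho rho_ge0.
  apply: closedI => //; apply: closedI; apply: preimage_closed => // q _.
    exact: cvg_fst.
  exact: cvg_snd.
- move=> x [Cx _]; apply/convex_setP => y z t fy fz t01; rewrite /F /=.
  by apply: le_lt_trans (f_quasiconvex x Cx y z t t01) _; rewrite gt_max fy fz.
- by move=> x [Cx _]; rewrite /F /= f_diag// ltxx.
- move=> x y _ [Cy _] fxy; have := f_usc y Cy x 0 fxy.
  by apply: filterS => b fb _.
- exact: Vopen.
- exact: VD.
exists x; split => // y Kxy; rewrite leNgt; apply/negP => fxy.
have Sx_ge0 z : K x z -> cball rho z -> 0 <= f x z.
  move=> Kxz zr; rewrite leNgt; apply/negP => fxz.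
  by have : (S x `&` F x) z by []; rewrite SF0.
have Fixx : Fix C K x by [].
have [w [Kxw wr fxw]] : exists w, [/\ K x w, enorm w < rho & f x w <= 0].
  have [rz [/andP[rz0 rzr] Hrz]] := K_coercive x Fixx.
  have [xrz|xrz] := leP (enorm x) rz.
    by exists x; rewrite f_diag// lexx; split => //; exact: le_lt_trans rzr.
  have [|w [Kxw wx fxw]] := Hrz x; first by split => //; apply/negP; rewrite -ltNge.
  by exists w; split => //; exact: lt_le_trans xr.
have [t t01 zr] := segment_meets_cball y rho_gt0 wr.
have Kxz : K x (t *: w + (1 - t) *: y).
  have /convex_setP cvKx := K_convex x Cx.
  by apply: cvKx => //; have /andP[/ltW -> /ltW ->] := t01.
by have := Sx_ge0 _ Kxz zr; rewrite leNgt f_strict.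
Qed.
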